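(* Let $A,B,C,D,A',B',C',D'$ be the eight points in $\mathbb{RP}^3$ of an elementary cube of a generic $Q$-net, where $X$ and $X'$ are antipodal vertices of the cube, so that the six quadruples $\{A',B,D,C\}$, $\{A,B',C,D\}$, $\{A,D,B,C'\}$, $\{A,B',D',C'\}$, $\{A',B,C',D'\}$, $\{B',C,A',D'\}$ are coplanar. Consider the local planar bipartite graph with white vertices carrying $A,B,C,A',B',C',D$ and three black vertices $a',b',c'$ around $D$, with neighborhoods $a'=\{A',B,D,C\}$, $b'=\{A,B',C,D\}$, $c'=\{A,D,B,C'\}$. Perform the following sequence of moves on the circuit configuration of points: (i) urban renewal at the quadrilateral face $C,a',D,b'$, followed by removal of the degree two white vertex carrying $D$; (ii) urban renewal at the quadrilateral face whose white vertices are $B$ and the point $G$ created in (i), followed by removal of the resulting degree two black vertex at $A'$; (iii) urban renewal at the quadrilateral face whose white vertices are $A$ and the point $H$ created in (i), followed by removal of the resulting degree two black vertex at $B'$; (iv) removal of the degree two white vertices carrying $G$ and $H$; (v) urban renewal at the quadrilateral face whose white vertices are the points $F$ and $E$ newly created in (ii) and (iii) respectively, followed by removal of the resulting degree two black vertex at $C'$ and of the degree two white vertices carrying $E$ and $F$. The intermediate points are $G=A'B\cap CD$, $H=AB'\cap CD$, $F=C'D'\cap A'B$, $E=C'D'\cap AB'$. The result is the local bipartite graph with white vertices carrying $A,B,C,A',B',C',D'$ and three black vertices around $D'$ with neighborhoods $\{A,B',D',C'\}$, $\{A',B,C',D'\}$, $\{B',C,A',D'\}$. Thus the sequence of moves realizes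 geometrically a step of the time evolution of the $Q$-net, replacing the vertex $D$ of the cube by $D'$ and leaving the other points unchanged.
   Context: A $3$-dimensional $Q$-net is a map $f:\mathbb{Z}^3\to\mathbb{R}^3$ such that for every $u\in\mathbb{Z}^3$ and indices $i\ne j$ the points $f(u),f(u+e_i),f(u+e_j),f(u+e_i+e_j)$ are coplanar. In an elementary cube the point $f(u+e_1+e_2+e_3)$ is generically the unique intersection of the three planes spanned by the three faces through it, each determined by the three other points of that face; this is the time evolution (from the generations $|u|=t,t+1,t+2$, where $|u|$ is the sum of coordinates, to $t+1,t+2,t+3$). Here $D=f(u)$, $\{A,B,C\}=\{f(u+e_i)\}$, $\{A',B',C'\}=\{f(u+e_i+e_j)\}$, $D'=f(u+e_1+e_2+e_3)$. A circuit configuration of points on a planar bipartite graph assigns to each white vertex $w$ a point $P_w$ of projective space such that for each black vertex $b$ the points at its neighbors $N(b)$ form a circuit (dependent, with every proper subset independent, in terms of lifts to vectors). For a quadrilateral face $F$ with white vertices $w_1,w_2$ and black vertices $b_1,b_2$ of degree at least $3$, put $P(F,b_i)=\langle P_{w_1},P_{w_2}\rangle\cap\langle\{P_w:w\in N(b_i)\setminus\{w_1,w_2\}\}\rangle$ (spans). If $P(F,b_1)\neq P(F,b_2)$, urban renewal at $F$ deletes the four edges of $F$, adds white vertices $x_1,x_2$ carrying $P(F,b_1),P(F,b_2)$ and black vertices $s_1,s_2$, and adds the edges $\overline{b_ix_i}$, $\overline{w_is_i}$ and all $\overline{x_is_j}$ (with $x_1,s_1,x_2,s_2$ bounding a quadrilateral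 inside $F$). Removal of a degree two vertex deletes it and merges its two neighbors (of the same color) into one vertex; when the removed vertex is black, the two merged white vertices carry the same point. ''Generic'' means that all these moves are defined and all the configurations encountered are circuit configurations. *)

(* Defs.v *)
From mathcomp Require Import all_boot all_order all_algebra.
From mathcomp Require Import reals.

Set Implicit Arguments.
Unset Strict Implicit.
Unset Printing Implicit Defensive.

Import GRing.Theory.

(* Cyclic sequences are represented by lists, up to rotation. *)
Section Cyclic.

Definition cyc_eq (s t : seq nat) := exists n, s = rot n t.

Definition from (v : nat) (s : seq nat) := rot (index v s) s.

(* The cyclic sequence s, with v and its successor both replaced by v'. *)
Definition replace2 (v v' : nat) (s : seq nat) := v' :: drop 2 (from v s).

(* The entries of the cyclic sequence s other than v, starting after v. *)
Definition others (v : nat) (s : seq nat) := behead (from v s).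

Definition rename (v v' : nat) (s : seq nat) :=
  [seq if x == v then v' else x | x <- s].

End Cyclic.

(* A point of the projective space of V is a line of V, i.e., a subspace of
   dimension 1; the span of points is then the sum of subspaces, and equality
   of points is Leibniz equality. *)
Section Configurations.

Variables (K : fieldType) (V : vectType K).

(* vpick U is a lift of the point U. *)
Definition independent (s : seq {vspace V}) := free [seq vpick U | U <- s].

Definition circuit (s : seq {vspace V}) :=
  ~~ independent s /\
  (forall t, subseq t s -> (size t < size s)%N -> independent t).

(* A bipartite graph embedded in an oriented surface, given by its rotation
   system, with a subspace attached to each white vertex. White and black
   vertices are named by natural numbers, independently. wrot w lists the black
   neighbors of w in counterclockwise order, brot b the white neighbors of b.
   A name is a vertex of the graph iff its list is not empty (there are no
   isolated vertices); pt is irrelevant at the other names. *)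
Record config := Config {
  wrot : nat -> seq nat;
  brot : nat -> seq nat;
  pt : nat -> {vspace V} }.

Definition bipartite_graph (c : config) :=
  [/\ forall w, uniq (wrot c w),
      forall b, uniq (brot c b)
    & forall w b, (b \in wrot c w) = (w \in brot c b)].

(* Planarity is Euler's formula for each finite set S of edges (w, b), with the
   rotation system it inherits. next_side runs along the boundary of a face,
   through its sides from white to black, with the face on the right: from w to
   b, then to the successor w' of w around b, then to the successor of b around
   w'. As each face alternates colors, its boundary is one cycle of next_side. *)
Section Planarity.

Variables (c : config) (S : seq (nat * nat)).

Definition next_side (e : nat * nat) :=
  let w := next [seq v <- brot c e.2 | (v, e.2) \in S] e.1 in
  (w, next [seq v <- wrot c w | (w, v) \in S] e.2).

Definition nb_faces :=
  fcard (fun e : seq_sub S => insubd e (next_side (val e))) predT.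

Definition nb_components :=
  n_comp (fun e e' : seq_sub S =>
    ((val e).1 == (val e').1) || ((val e).2 == (val e').2)) predT.

Definition euler_formula :=
  (size (undup (unzip1 S)) + size (undup (unzip2 S)) + nb_faces =
   size S + 2 * nb_components)%N.

End Planarity.

Definition planar (c : config) :=
  forall S : seq (nat * nat), uniq S ->
  (forall e, e \in S -> e.2 \in wrot c e.1) -> euler_formula c S.

Definition circuit_config (c : config) :=
  (forall w, wrot c w != [::] -> \dim (pt c w) = 1%N) /\
  (forall b, brot c b != [::] -> circuit [seq pt c w | w <- brot c b]).

(* The vertices w1, b1, w2, b2 bound a face, in clockwise order. *)
Definition quad_face (c : config) (w1 b1 w2 b2 : nat) :=
  [/\ w1 != w2 /\ b1 != b2,
      next (brot c b1) w1 = w2, next (wrot c w2) b1 = b2,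
      next (brot c b2) w2 = w1 & next (wrot c w1) b2 = b1].

(* P(F, b) for a face F with white vertices w1 and w2 *)
Definition face_point (c : config) (w1 w2 b : nat) : {vspace V} :=
  ((pt c w1 + pt c w2) :&:
   \sum_(w <- brot c b | w \notin [:: w1; w2]) pt c w)%VS.

(* Urban w1 b1 w2 b2 x1 s1 x2 s2 : urban renewal at the face w1, b1, w2, b2, the
     new vertices being the white x1, x2 and the black s1, s2.
   RemoveWhite w b1 b2 : removal of w, whose neighbors are b1 and b2; the merged
     vertex is named b1.
   RemoveBlack b w1 w2 : removal of b, whose neighbors are w1 and w2; the merged
     vertex is named w1. *)
Inductive move :=
  | Urban of nat & nat & nat & nat & nat & nat & nat & nat
  | RemoveWhite of nat & nat & nat
  | RemoveBlack of nat & nat & nat.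

Definition urban_renewal (c : config) (w1 b1 w2 b2 x1 s1 x2 s2 : nat) :=
  Config
    [eta wrot c with
       w1 |-> replace2 b2 s1 (wrot c w1), w2 |-> replace2 b1 s2 (wrot c w2),
       x1 |-> [:: b1; s1; s2], x2 |-> [:: b2; s2; s1]]
    [eta brot c with
       b1 |-> replace2 w1 x1 (brot c b1), b2 |-> replace2 w2 x2 (brot c b2),
       s1 |-> [:: w1; x2; x1], s2 |-> [:: w2; x1; x2]]
    [eta pt c with x1 |-> face_point c w1 w2 b1, x2 |-> face_point c w1 w2 b2].

Definition remove_white (c : config) (w b1 b2 : nat) :=
  Config
    (fun v => if v == w then [::] else rename b2 b1 (wrot c v))
    [eta brot c with
       b1 |-> others w (brot c b1) ++ others w (brot c b2), b2 |-> [::]]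
    (pt c).

Definition remove_black (c : config) (b w1 w2 : nat) :=
  Config
    [eta wrot c with
       w1 |-> others b (wrot c w1) ++ others b (wrot c w2), w2 |-> [::]]
    (fun v => if v == b then [::] else rename w2 w1 (brot c v))
    (pt c).

Definition apply_move (m : move) (c : config) : config :=
  match m with
  | Urban w1 b1 w2 b2 x1 s1 x2 s2 => urban_renewal c w1 b1 w2 b2 x1 s1 x2 s2
  | RemoveWhite w b1 b2 => remove_white c w b1 b2
  | RemoveBlack b w1 w2 => remove_black c b w1 w2
  end.

(* The requirements of a move, except for P(F, b1) != P(F, b2). For removals,
   the uniqueness condition says that no multiple edge is created. *)
Definition admissible (m : move) (c : config) : Prop :=
  match m with
  | Urban w1 b1 w2 b2 x1 s1 x2 s2 =>
      [/\ quad_face c w1 b1 w2 b2,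
          (2 < size (brot c b1))%N /\ (2 < size (brot c b2))%N,
          [/\ x1 != x2, wrot c x1 = [::] & wrot c x2 = [::]]
        & [/\ s1 != s2, brot c s1 = [::] & brot c s2 = [::]]]
  | RemoveWhite w b1 b2 =>
      [/\ b1 != b2, cyc_eq (wrot c w) [:: b1; b2]
        & uniq (others w (brot c b1) ++ others w (brot c b2))]
  | RemoveBlack b w1 w2 =>
      [/\ w1 != w2, cyc_eq (brot c b) [:: w1; w2],
          uniq (others b (wrot c w1) ++ others b (wrot c w2))
        & pt c w1 = pt c w2]
  end.

Definition nondegenerate (m : move) (c : config) : Prop :=
  if m is Urban w1 b1 w2 b2 _ _ _ _
  then face_point c w1 w2 b1 <> face_point c w1 w2 b2 else True.

Definition run (c : config) (ms : seq move) : config :=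
  foldl (fun c m => apply_move m c) c ms.

Fixpoint admissible_run (c : config) (ms : seq move) : Prop :=
  if ms is m :: ms' then
    admissible m c /\ admissible_run (apply_move m c) ms'
  else True.

(* All the configurations encountered are circuit configurations, and each urban
   renewal satisfies P(F, b1) != P(F, b2). *)
Fixpoint generic_run (c : config) (ms : seq move) : Prop :=
  circuit_config c /\
  (if ms is m :: ms' then
     nondegenerate m c /\ generic_run (apply_move m c) ms'
   else True).

(* The local graph around a white vertex D of degree 3, inside an ambient graph:
   D has the black neighbors x, y, z, with neighborhoods {D, Y, X', Z},
   {D, Z, Y', X}, {D, X, Z', Y}, and is surrounded by three quadrilateral faces.
   out V lists, from one end to the other, the black neighbors of V outside of
   the local graph, which is the whole graph around V when out V is empty. *)
Definition star (c : config) (D X Y Z X' Y' Z' x y z : nat)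
    (out : nat -> seq nat) :=
  [/\ uniq [:: D; X; Y; Z; X'; Y'; Z'] /\ uniq [:: x; y; z],
      cyc_eq (wrot c D) [:: x; y; z],
      [/\ cyc_eq (brot c x) [:: D; Y; X'; Z],
          cyc_eq (brot c y) [:: D; Z; Y'; X]
        & cyc_eq (brot c z) [:: D; X; Z'; Y]],
      [/\ cyc_eq (wrot c X) [:: z, y & out X],
          cyc_eq (wrot c Y) [:: x, z & out Y]
        & cyc_eq (wrot c Z) [:: y, x & out Z]]
    & [/\ cyc_eq (wrot c X') (x :: out X'),
          cyc_eq (wrot c Y') (y :: out Y')
        & cyc_eq (wrot c Z') (z :: out Z')]].

End Configurations.

Section QNets.

Variable R : realType.

(* The projective space RP^3 is that of R^4, in which R^3 is embedded by
   p |-> [p : 1]. *)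
Definition homog (p : 'rV[R]_3) : {vspace 'rV[R]_4} :=
  <[row_mx p (1%:M : 'M[R]_1)]>%VS.

Definition coplanar (s : seq {vspace 'rV[R]_4}) :=
  exists2 H : {vspace 'rV[R]_4}, \dim H = 3%N &
    forall U, U \in s -> (U <= H)%VS.

Definition unit_step (i : 'I_3) : 'rV[int]_3 := delta_mx 0%R i.

Local Open Scope ring_scope.

Definition Qnet (f : 'rV[int]_3 -> 'rV[R]_3) :=
  forall (u : 'rV[int]_3) (i j : 'I_3), i != j ->
  coplanar [seq homog (f v) | v <- [:: u; u + unit_step i; u + unit_step j;
                                       u + unit_step i + unit_step j]].

End QNets.

(* Main.v *)
Require Import Defs.
From mathcomp Require Import all_boot all_order all_algebra.
From mathcomp Require Import reals.

Set Implicit Arguments.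
Unset Strict Implicit.
Unset Printing Implicit Defensive.

Import GRing.Theory.

(* Combinatorics. Everything happens in a concrete local graph, in which the
   neighbors of a vertex outside of it are a single block of its cyclic order.
   Replacing each such block by a fixed extra neighbor gives a concrete model,
   whose vertices are small numbers. The moves commute with the expansion of
   these blocks, so that their effect is computed on the model.

   Geometry. Let H1, H2, H3 be the planes AB'C', A'BC', A'B'C. The circuit
   A, B, C', G, H obtained in (i) shows that H1 and H2 are distinct, hence meet
   in the line EF, which contains C'. The circuit C, F, A', B', E obtained in
   (iv) shows that EF is not contained in H3. So the three planes have only one
   point in common. Both the point created in (v) and the last vertex of the
   cube lie in all three planes, hence are equal. *)

(** * Lists up to rotation *)

Section CyclicSequences.

Implicit Types (v w : nat) (s t : seq nat).

Lemma cyc_eq_sym s t : cyc_eq s t -> cyc_eq t s.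
Proof.
by case=> n ->; exists (size (rot n t) - n)%N; rewrite -[LHS](rotK n).
Qed.

Lemma cyc_eq_refl s : cyc_eq s s.
Proof. by exists 0; rewrite rot0. Qed.

Lemma cyc_eq_trans t s u : cyc_eq s t -> cyc_eq t u -> cyc_eq s u.
Proof.
case=> m -> [n ->]; case: (leqP m (size u)) => [le_m|lt_m]; last first.
  by exists n; rewrite rot_oversize // size_rot ltnW.
case: (leqP n (size u)) => [le_n|lt_n]; last first.
  by exists m; rewrite [rot n u]rot_oversize // ltnW.
by rewrite rot_add_mod //; eexists.
Qed.

Lemma cyc_eq_catC s t : cyc_eq (s ++ t) (t ++ s).
Proof. by exists (size t); rewrite rot_size_cat. Qed.

Lemma cyc_eq_perm s t : cyc_eq s t -> perm_eq s t.
Proof. by case=> n ->; rewrite perm_rot. Qed.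

Lemma cyc_eq_uniq s t : cyc_eq s t -> uniq s = uniq t.
Proof. by move/cyc_eq_perm/perm_uniq. Qed.

Lemma cyc_eq_mem s t : cyc_eq s t -> s =i t.
Proof. by move/cyc_eq_perm/perm_mem. Qed.

Lemma cyc_eq_map (f : nat -> nat) s t :
  cyc_eq s t -> cyc_eq (map f s) (map f t).
Proof. by case=> n ->; exists n; rewrite map_rot. Qed.

Lemma cyc_eq_nil s : cyc_eq s [::] <-> s = [::].
Proof. by split=> [[n]|->]; [case: n | exists 0]. Qed.

(** In a duplicate-free list only one rotated list starts with [v], so all that is computed through
    [from] depends on the cyclic order alone. *)
Lemma from_cyc_eq v s t : uniq s -> cyc_eq s (v :: t) -> from v s = v :: t.
Proof.
move=> s_uniq [[|n] def_s]; rewrite {}def_s in s_uniq *.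
  by rewrite rot0 /from /= eqxx rot0.
case: (leqP (size t) n) => [le_n|lt_n].
  by rewrite rot_oversize // /from /= eqxx rot0.
move: s_uniq; rewrite rot_uniq /= => /andP[v_t _].
have v_drop : v \notin drop n t by apply: contra v_t => /mem_drop.
rewrite /from /rot /= index_cat (negPf v_drop) /= eqxx addn0.
by rewrite drop_size_cat // take_size_cat //= cat_take_drop.
Qed.

Lemma cyc_eq_from v s : v \in s -> cyc_eq s (v :: others v s).
Proof.
move=> v_s; apply: cyc_eq_sym; exists (index v s).
by rewrite /others /from rot_index.
Qed.

Lemma others_cyc_eq v s t : uniq s -> cyc_eq s (v :: t) -> others v s = t.
Proof. by move=> s_uniq s_t; rewrite /others (from_cyc_eq s_uniq s_t). Qed.

Lemma replace2_cyc_eq v b v' s t :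
  uniq s -> cyc_eq s [:: v, b & t] -> replace2 v v' s = v' :: t.
Proof.
by move=> s_uniq s_t; rewrite /replace2 (from_cyc_eq s_uniq s_t) /= drop0.
Qed.

Lemma next_cyc_eq v b s t : uniq s -> cyc_eq s [:: v, b & t] -> next s v = b.
Proof.
move=> s_uniq s_t; have := s_uniq; rewrite (cyc_eq_uniq s_t) => vbt_uniq.
by case: s_t => n ->; rewrite next_rot //= eqxx.
Qed.

(** [next s v] is [v] when [v] is absent from [s] or alone in it. The hypothesis excludes both
    cases. *)
Lemma cyc_eq_next v s : uniq s -> next s v != v ->
  exists t, cyc_eq s [:: v, next s v & t].
Proof.
move=> s_uniq; have [v_s|] := boolP (v \in s); last first.
  by rewrite next_nth => /negPf->; rewrite eqxx.
have s_v := cyc_eq_from v_s; case: (others v s) s_v => [|b t] s_v.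
  by have [n ->] := s_v; rewrite next_rot //= eqxx eqxx.
by exists t; rewrite (next_cyc_eq s_uniq s_v).
Qed.

Lemma rename_id v v' s : v \notin s -> rename v v' s = s.
Proof.
move=> v_s; rewrite /rename map_id_in // => x x_s.
by case: eqP x_s => // ->; rewrite (negPf v_s).
Qed.

Lemma cyc_eq_cons_neq0 v s t : cyc_eq s (v :: t) -> s != [::].
Proof. by case=> n ->; rewrite -size_eq0 size_rot. Qed.

Lemma all_others (a : pred nat) v s : all a s -> v \in s -> all a (others v s).
Proof.
move=> a_s /cyc_eq_from/cyc_eq_perm/perm_all all_s.
by move: a_s; rewrite all_s => /andP[].
Qed.

(** A boolean test, so that cyclic orders of concrete lists are compared by evaluation. *)
Definition cyc_eqb s t := has (fun n => s == rot n t) (iota 0 (size t).+1).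

Lemma cyc_eqP s t : cyc_eqb s t -> cyc_eq s t.
Proof. by case/hasP=> n _ /eqP->; exists n. Qed.

End CyclicSequences.

(** * Expansion of model lists, a block replacing the placeholder *)

Section Expansion.

Variable (names : seq nat).
Implicit Types (tl l : seq nat).

(* The index size names is the placeholder for the list tl. *)
Definition expand tl l :=
  flatten [seq nth tl [seq [:: v] | v <- names] x | x <- l].

Lemma expand_cat tl l1 l2 :
  expand tl (l1 ++ l2) = expand tl l1 ++ expand tl l2.
Proof. by rewrite /expand map_cat flatten_cat. Qed.

Lemma expand_cons tl x l : (x < size names)%N ->
  expand tl (x :: l) = nth 0 names x :: expand tl l.
Proof. by move=> lt_x; rewrite /expand /= (nth_map 0). Qed.

Lemma expand_tail tl : expand tl [:: size names] = tl.
Proof. by rewrite /expand /= nth_default ?size_map // cats0. Qed.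

Lemma expand_notail tl l : all (gtn (size names)) l ->
  expand tl l = [seq nth 0 names x | x <- l].
Proof.
elim: l => //= x l IHl /andP[lt_x lt_l].
by rewrite expand_cons // IHl.
Qed.

(** A rotation exchanges a prefix and a suffix, and expansion respects concatenation, so the
    expanded pieces are exchanged too, possibly by a rotation of another amount. *)
Lemma cyc_eq_expand tl l1 l2 :
  cyc_eq l1 l2 -> cyc_eq (expand tl l1) (expand tl l2).
Proof.
case=> n ->; rewrite /rot expand_cat.
apply: cyc_eq_trans (cyc_eq_catC _ _) _.
by rewrite -expand_cat cat_take_drop; apply: cyc_eq_refl.
Qed.

Lemma mem_expand tl l x : (x < size names)%N -> x \in l ->
  nth 0 names x \in expand tl l.
Proof.
move=> lt_x x_l; apply/flattenP; exists [:: nth 0 names x].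
  by apply/mapP; exists x; rewrite ?(nth_map 0).
by rewrite inE.
Qed.

Hypothesis names_uniq : uniq names.

Lemma nth_names x y : (x < size names)%N -> (y < size names)%N ->
  (nth 0 names x == nth 0 names y) = (x == y).
Proof. by move=> lt_x lt_y; apply: nth_uniq. Qed.

Lemma expand_mem tl l x : (x < size names)%N -> nth 0 names x \notin tl ->
  (nth 0 names x \in expand tl l) = (x \in l).
Proof.
move=> lt_x x_tl; apply/idP/idP; last exact: mem_expand.
case/flattenP=> _ /mapP[y y_l ->].
case: (ltnP y (size names)) => [lt_y|le_y].
  by rewrite (nth_map 0) // inE nth_names // => /eqP->.
by rewrite [nth tl _ y]nth_default ?size_map // (negPf x_tl).
Qed.

Lemma nth_names_neq x v : (x < size names)%N -> v \notin names ->
  (v == nth 0 names x) = false.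
Proof.
by move=> lt_x v_names; apply: contraNF v_names => /eqP->; apply: mem_nth.
Qed.

Definition fresh_tail tl := uniq tl && all (fun v => v \notin tl) names.

(** The bound makes [size names] the only index in [l] that expands to [tl], so the block is
    inserted at most once; freshness keeps it apart from the names. *)
Lemma expand_uniq tl l : fresh_tail tl -> all (geq (size names)) l -> uniq l ->
  uniq (expand tl l).
Proof.
case/andP=> tl_uniq names_tl; elim: l => //= x l IHl.
case/andP=> le_x le_l /andP[x_l l_uniq].
have {}IHl := IHl le_l l_uniq.
case: (ltnP x (size names)) => [lt_x|ge_x].
  rewrite expand_cons //= IHl expand_mem ?x_l //.
  by apply: (allP names_tl); rewrite mem_nth.
have {le_x ge_x} def_x : x = size names by apply/eqP; rewrite eqn_leq le_x.
rewrite -cat1s expand_cat {1}def_x expand_tail cat_uniq tl_uniq IHl andbT /=.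
apply/hasPn=> v /flattenP[_ /mapP[y y_l ->]].
have lt_y : (y < size names)%N.
  rewrite ltn_neqAle [(y <= _)%N](allP le_l _ y_l) andbT -def_x.
  by apply: contraNneq x_l => <-.
rewrite (nth_map 0) // inE => /eqP->.
by apply: (allP names_tl); rewrite mem_nth.
Qed.

Lemma expand_rename tl l x y : (x < size names)%N -> (y < size names)%N ->
  nth 0 names y \notin tl ->
  rename (nth 0 names y) (nth 0 names x) (expand tl l) =
    expand tl (rename y x l).
Proof.
move=> lt_x lt_y y_tl; rewrite /rename /expand map_flatten -!map_comp.
congr flatten; apply: eq_map => z /=.
case: (ltnP z (size names)) => [lt_z|le_z].
  rewrite (nth_map 0) //= nth_names //.
  by case: (z =P y) => _; rewrite (nth_map 0).
rewrite [nth tl _ z]nth_default ?size_map //; case: (z =P y) => [z_y|_].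
  by move: lt_y; rewrite -z_y ltnNge le_z.
rewrite [RHS]nth_default ?size_map // map_id_in // => v v_tl.
by case: (v =P nth 0 names y) v_tl => // ->; rewrite (negPf y_tl).
Qed.

Section ExpandedList.

Variables (tl s l : seq nat).
Hypotheses (tl_fresh : fresh_tail tl) (le_l : all (geq (size names)) l).
Hypotheses (l_uniq : uniq l) (s_l : cyc_eq s (expand tl l)).

Lemma expanded_uniq : uniq s.
Proof. by rewrite (cyc_eq_uniq s_l) expand_uniq. Qed.

Lemma expanded_others x : (x < size names)%N -> x \in l ->
  others (nth 0 names x) s = expand tl (others x l).
Proof.
move=> lt_x x_l; apply: others_cyc_eq expanded_uniq _.
rewrite -expand_cons //; apply: cyc_eq_trans s_l _.
by apply: cyc_eq_expand; apply: cyc_eq_from.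
Qed.

(** As the successor of [x] is a name and not the placeholder, no outside block separates the two,
    and editing this pair commutes with expansion. *)
Lemma expanded_next x y : (x < size names)%N -> (y < size names)%N ->
  next l x = y -> y != x ->
  next s (nth 0 names x) = nth 0 names y /\
  (forall z, (z < size names)%N ->
     replace2 (nth 0 names x) (nth 0 names z) s = expand tl (replace2 x z l)).
Proof.
move=> lt_x lt_y def_y; rewrite -{}def_y in lt_y * => ne_yx.
have [t l_t] := cyc_eq_next l_uniq ne_yx.
have s_t: cyc_eq s [:: nth 0 names x, nth 0 names (next l x) & expand tl t].
  rewrite -!expand_cons //; apply: cyc_eq_trans s_l _.
  exact: cyc_eq_expand.
split=> [|z lt_z]; first exact: next_cyc_eq expanded_uniq s_t.
rewrite (replace2_cyc_eq _ expanded_uniq s_t) (replace2_cyc_eq _ l_uniq l_t).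
by rewrite expand_cons.
Qed.

End ExpandedList.

End Expansion.

(** * Simulation of the moves on a concrete model *)

Section LocalModel.

Variables (K : fieldType) (V : vectType K).
Implicit Types (c m : config V) (mv : move) (mvs : seq move).

Variables (ws bs : seq nat) (tl : nat -> seq nat) (nw0 : nat) (amb : config V).

Definition instance mv :=
  match mv with
  | Urban w1 b1 w2 b2 x1 s1 x2 s2 =>
      Urban (nth 0 ws w1) (nth 0 bs b1) (nth 0 ws w2) (nth 0 bs b2)
            (nth 0 ws x1) (nth 0 bs s1) (nth 0 ws x2) (nth 0 bs s2)
  | RemoveWhite w b1 b2 =>
      RemoveWhite (nth 0 ws w) (nth 0 bs b1) (nth 0 bs b2)
  | RemoveBlack b w1 w2 =>
      RemoveBlack (nth 0 bs b) (nth 0 ws w1) (nth 0 ws w2)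
  end.

(* The local graph of c has the vertices ws and bs, named in the model m by
   their indices in these lists; c coincides with amb outside of it. In m, the
   black name size bs stands for all the neighbors of the i-th white vertex
   outside of the local graph, listed in tl i. *)
Definition models m c :=
  [/\ forall i, (i < size ws)%N ->
        cyc_eq (wrot c (nth 0 ws i)) (expand bs (tl i) (wrot m i)),
      forall j, (j < size bs)%N ->
        cyc_eq (brot c (nth 0 bs j)) (expand ws [::] (brot m j)),
      forall i, (i < size ws)%N -> pt c (nth 0 ws i) = pt m i,
      forall w, w \notin ws -> wrot c w = wrot amb w /\ pt c w = pt amb w
    & forall b, b \notin bs -> brot c b = brot amb b].

Definition well_formed m :=
  all (fun j => uniq (brot m j) &&
    all (fun w => (w < size ws)%N && (j \in wrot m w)) (brot m j))
    (iota 0 (size bs)) &&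
  all (fun i => uniq (wrot m i) && all (geq (size bs)) (wrot m i))
    (iota 0 (size ws)).

(* The white vertices of index less than nw0 are those of the initial graph. *)
Definition legal mv m :=
  well_formed m &&
  match mv with
  | Urban w1 b1 w2 b2 x1 s1 x2 s2 =>
      [&& all (gtn (size ws)) [:: w1; w2; x1; x2],
          all (gtn (size bs)) [:: b1; b2; s1; s2],
          [&& w1 != w2, b1 != b2, x1 != x2 & s1 != s2],
          [&& next (brot m b1) w1 == w2, next (wrot m w2) b1 == b2,
              next (brot m b2) w2 == w1 & next (wrot m w1) b2 == b1],
          (2 < size (brot m b1))%N && (2 < size (brot m b2))%N
        & [&& wrot m x1 == [::], wrot m x2 == [::],
              brot m s1 == [::] & brot m s2 == [::]]]
  | RemoveWhite w b1 b2 =>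
      [&& (w < size ws)%N, all (gtn (size bs)) [:: b1; b2], b1 != b2,
          cyc_eqb (wrot m w) [:: b1; b2],
          (w \in brot m b1) && (w \in brot m b2)
        & uniq (others w (brot m b1) ++ others w (brot m b2))]
  | RemoveBlack b w1 w2 =>
      [&& (b < size bs)%N, all (gtn (size ws)) [:: w1; w2],
          (nw0 <= w2)%N && (w1 != w2),
          cyc_eqb (brot m b) [:: w1; w2],
          [&& b \in wrot m w1, b \in wrot m w2 & size bs \notin wrot m w2]
        & uniq (others b (wrot m w1) ++ others b (wrot m w2))]
  end.

(** The one requirement of admissibility that evaluation on indices cannot decide. It is kept apart
    from [legal] and later derived from the circuits. *)
Definition mergeable mv m :=
  if mv is RemoveBlack _ w1 w2 then pt m w1 = pt m w2 else True.

Hypotheses (ws_uniq : uniq ws) (bs_uniq : uniq bs).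
Hypothesis tl_fresh : forall i, (i < size ws)%N -> fresh_tail bs (tl i).
Hypothesis amb_wrot :
  forall w b, w \notin ws -> b \in bs -> b \notin wrot amb w.
Hypothesis amb_brot : forall b i, b \notin bs -> (nw0 <= i < size ws)%N ->
  nth 0 ws i \notin brot amb b.

Lemma nil_fresh : fresh_tail ws [::].
Proof. by apply/andP; split=> //; apply/allP. Qed.

Lemma well_formed_brot m j : well_formed m -> (j < size bs)%N ->
  [/\ uniq (brot m j), all (gtn (size ws)) (brot m j),
      all (geq (size ws)) (brot m j)
    & forall w, w \in brot m j -> j \in wrot m w].
Proof.
case/andP=> wfb _ lt_j; have := allP wfb j.
rewrite mem_iota add0n => /(_ lt_j) /andP[uniq_j /allP wj].
split=> //; [apply/allP|apply/allP|] => w /wj /andP[] //= lt_w _.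
exact: ltnW.
Qed.

Lemma well_formed_wrot m i : well_formed m -> (i < size ws)%N ->
  uniq (wrot m i) /\ all (geq (size bs)) (wrot m i).
Proof.
by case/andP=> _ wfw lt_i; have := allP wfw i;
   rewrite mem_iota add0n => /(_ lt_i) /andP.
Qed.

(** The sum over the neighbors of [b] ignores their order, and black lists of the model contain no
    placeholder. *)
Lemma models_face_point m c w1 w2 b : models m c -> well_formed m ->
  (w1 < size ws)%N -> (w2 < size ws)%N -> (b < size bs)%N ->
  face_point c (nth 0 ws w1) (nth 0 ws w2) (nth 0 bs b) = face_point m w1 w2 b.
Proof.
move=> [_ brot_mc pt_mc _ _] wf lt_w1 lt_w2 lt_b; rewrite /face_point !pt_mc //.
have [_ lt_ws _ _] := well_formed_brot wf lt_b.
have := cyc_eq_perm (brot_mc b lt_b); rewrite expand_notail // => s_b.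
congr (_ :&: _)%VS; rewrite (perm_big _ s_b) big_map /=.
rewrite [LHS]big_seq_cond [RHS]big_seq_cond; apply: eq_big => w.
  case: (boolP (w \in _)) => //= /(allP lt_ws) lt_w.
  by rewrite !inE !nth_names.
by case/andP=> /(allP lt_ws) lt_w _; rewrite pt_mc.
Qed.

Lemma models_wrot_nil m c i : models m c -> (i < size ws)%N ->
  wrot m i = [::] -> wrot c (nth 0 ws i) = [::].
Proof.
case=> wrot_mc _ _ _ _ lt_i nil_i; apply/cyc_eq_nil.
by have := wrot_mc _ lt_i; rewrite nil_i.
Qed.

Lemma models_brot_nil m c j : models m c -> (j < size bs)%N ->
  brot m j = [::] -> brot c (nth 0 bs j) = [::].
Proof.
case=> _ brot_mc _ _ _ lt_j nil_j; apply/cyc_eq_nil.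
by have := brot_mc _ lt_j; rewrite nil_j.
Qed.

(** In each of the four cyclic orders around the face, the two neighbors on the face are consecutive
    names, so [expanded_next] applies to each. *)
Lemma models_urban m c w1 b1 w2 b2 x1 s1 x2 s2 :
  let mv := Urban w1 b1 w2 b2 x1 s1 x2 s2 in
  models m c -> legal mv m ->
  admissible (instance mv) c /\
  models (apply_move mv m) (apply_move (instance mv) c).
Proof.
move=> /= mod /andP[wf].
case/and5P=> /and5P[lt_w1 lt_w2 lt_x1 lt_x2 _].
move=> /and5P[lt_b1 lt_b2 lt_s1 lt_s2 _].
case/and4P=> w12 b12 x12 s12.
case/and4P=> /eqP next_b1 /eqP next_w2 /eqP next_b2 /eqP next_w1.
case/andP=> /andP[sz_b1 sz_b2].
case/and4P=> /eqP nil_x1 /eqP nil_x2 /eqP nil_s1 /eqP nil_s2.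
have [wrot_mc brot_mc pt_mc out_w out_b] := mod.
have [uniq_b1 lt_lb1 le_b1 _] := well_formed_brot wf lt_b1.
have [uniq_b2 lt_lb2 le_b2 _] := well_formed_brot wf lt_b2.
have [uniq_w1 le_w1] := well_formed_wrot wf lt_w1.
have [uniq_w2 le_w2] := well_formed_wrot wf lt_w2.
have [nx_b1 rp_b1] := expanded_next ws_uniq nil_fresh le_b1 uniq_b1
  (brot_mc _ lt_b1) lt_w1 lt_w2 next_b1 ltac:(by rewrite eq_sym).
have [nx_b2 rp_b2] := expanded_next ws_uniq nil_fresh le_b2 uniq_b2
  (brot_mc _ lt_b2) lt_w2 lt_w1 next_b2 w12.
have [nx_w1 rp_w1] := expanded_next bs_uniq (tl_fresh lt_w1) le_w1 uniq_w1
  (wrot_mc _ lt_w1) lt_b2 lt_b1 next_w1 b12.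
have [nx_w2 rp_w2] := expanded_next bs_uniq (tl_fresh lt_w2) le_w2 uniq_w2
  (wrot_mc _ lt_w2) lt_b1 lt_b2 next_w2 ltac:(by rewrite eq_sym).
have size_brot b : (b < size bs)%N ->
    size (brot c (nth 0 bs b)) = size (brot m b).
  move=> lt_b; have [_ lt_lb _ _] := well_formed_brot wf lt_b.
  rewrite (perm_size (cyc_eq_perm (brot_mc _ lt_b))).
  by rewrite expand_notail ?size_map.
split.
  by split; [split; rewrite ?nth_names | rewrite !size_brot
    | rewrite nth_names // !(models_wrot_nil mod)
    | rewrite nth_names // !(models_brot_nil mod)].
split=> /=.
- move=> i lt_i; rewrite !nth_names //.
  case: (i =P w1) => [->|_]; first by rewrite rp_w1 //; apply: cyc_eq_refl.
  case: (i =P w2) => [->|_]; first by rewrite rp_w2 //; apply: cyc_eq_refl.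
  case: (i =P x1) => [->|_]; first by exists 0; rewrite rot0 !expand_cons.
  case: (i =P x2) => [->|_]; first by exists 0; rewrite rot0 !expand_cons.
  exact: wrot_mc.
- move=> j lt_j; rewrite !nth_names //.
  case: (j =P b1) => [_|_]; first by rewrite rp_b1 //; apply: cyc_eq_refl.
  case: (j =P b2) => [_|_]; first by rewrite rp_b2 //; apply: cyc_eq_refl.
  case: (j =P s1) => [_|_]; first by exists 0; rewrite rot0 !expand_cons.
  case: (j =P s2) => [_|_]; first by exists 0; rewrite rot0 !expand_cons.
  exact: brot_mc.
- move=> i lt_i; rewrite !nth_names // !(models_face_point mod) //.
  by rewrite pt_mc.
- by move=> w w_ws; rewrite !nth_names_neq //; apply: out_w.
- by move=> b b_bs; rewrite !nth_names_neq //; apply: out_b.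
Qed.

Lemma models_remove_white m c w b1 b2 :
  let mv := RemoveWhite w b1 b2 in
  models m c -> legal mv m ->
  admissible (instance mv) c /\
  models (apply_move mv m) (apply_move (instance mv) c).
Proof.
move=> /= [wrot_mc brot_mc pt_mc out_w out_b] /andP[wf].
case/and5P=> lt_w /and3P[lt_b1 lt_b2 _] b12 /cyc_eqP w_b12.
case/andP=> /andP[w_b1 w_b2] uniq_others.
have [uniq_b1 lt_lb1 le_b1 _] := well_formed_brot wf lt_b1.
have [uniq_b2 lt_lb2 le_b2 _] := well_formed_brot wf lt_b2.
have ot_b1 := expanded_others ws_uniq nil_fresh le_b1 uniq_b1
  (brot_mc _ lt_b1) lt_w w_b1.
have ot_b2 := expanded_others ws_uniq nil_fresh le_b2 uniq_b2
  (brot_mc _ lt_b2) lt_w w_b2.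
split.
  split; first by rewrite nth_names.
    apply: cyc_eq_trans (wrot_mc _ lt_w) _.
    have := cyc_eq_expand bs (tl w) w_b12.
    by rewrite !expand_cons.
  rewrite ot_b1 ot_b2 -expand_cat.
  apply: expand_uniq => //; first exact: nil_fresh.
  by rewrite all_cat !all_others.
split=> /=.
- move=> i lt_i; rewrite nth_names //; case: (i =P w) => [_|_].
    exact: cyc_eq_refl.
  rewrite -expand_rename //; first by apply: cyc_eq_map; apply: wrot_mc.
  by case/andP: (tl_fresh lt_i) => _ /allP; apply; apply: mem_nth.
- move=> j lt_j; rewrite !nth_names //.
  case: (j =P b1) => [_|_]; first
    by rewrite ot_b1 ot_b2 -expand_cat; apply: cyc_eq_refl.
  case: (j =P b2) => [_|_]; first exact: cyc_eq_refl.
  exact: brot_mc.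
- exact: pt_mc.
(* The renaming acts on every white vertex, but those outside [ws] have no neighbor in [bs] and are
   left unchanged. *)
- move=> v v_ws; rewrite nth_names_neq //; have [wrot_v ->] := out_w _ v_ws.
  split=> //; rewrite wrot_v rename_id //; apply: amb_wrot => //.
  exact: mem_nth.
- by move=> b b_bs; rewrite !nth_names_neq //; apply: out_b.
Qed.

Lemma models_remove_black m c b w1 w2 :
  let mv := RemoveBlack b w1 w2 in
  models m c -> legal mv m ->
  (mergeable mv m -> admissible (instance mv) c) /\
  models (apply_move mv m) (apply_move (instance mv) c).
Proof.
move=> /= [wrot_mc brot_mc pt_mc out_w out_b] /andP[wf].
case/and5P=> lt_b /and3P[lt_w1 lt_w2 _] /andP[new_w2 w12] /cyc_eqP b_w12.
case/andP=> /and3P[b_w1 b_w2 tail_w2] uniq_others.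
have [uniq_w1 le_w1] := well_formed_wrot wf lt_w1.
have [uniq_w2 le_w2] := well_formed_wrot wf lt_w2.
have ot_w1 := expanded_others bs_uniq (tl_fresh lt_w1) le_w1 uniq_w1
  (wrot_mc _ lt_w1) lt_b b_w1.
have ot_w2 := expanded_others bs_uniq (tl_fresh lt_w2) le_w2 uniq_w2
  (wrot_mc _ lt_w2) lt_b b_w2.
(* The merged list will be expanded with the block of [w1]. The list of [w2] has no placeholder, so
   its expansion does not depend on the block. *)
have {}ot_w2 : others (nth 0 bs b) (wrot c (nth 0 ws w2)) =
    expand bs (tl w1) (others b (wrot m w2)).
  have lt_others: all (gtn (size bs)) (others b (wrot m w2)).
    apply: all_others => //; apply/allP=> x x_w2.
    rewrite /= ltn_neqAle [(x <= _)%N](allP le_w2 _ x_w2) andbT.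
    by apply: contraNneq tail_w2 => <-.
  by rewrite ot_w2 !expand_notail.
split.
  split; [by rewrite nth_names | | | by rewrite !pt_mc].
    apply: cyc_eq_trans (brot_mc _ lt_b) _.
    have := cyc_eq_expand ws [::] b_w12.
    by rewrite !expand_cons.
  rewrite ot_w1 ot_w2 -expand_cat.
  apply: expand_uniq => //; first exact: tl_fresh.
  by rewrite all_cat !all_others.
split=> /=.
- move=> i lt_i; rewrite !nth_names //.
  case: (i =P w1) => [->|_]; first
    by rewrite ot_w1 ot_w2 -expand_cat; apply: cyc_eq_refl.
  case: (i =P w2) => [_|_]; first exact: cyc_eq_refl.
  exact: wrot_mc.
- move=> j lt_j; rewrite nth_names //; case: (j =P b) => [_|_].
    exact: cyc_eq_refl.
  rewrite -expand_rename //; by apply: cyc_eq_map; apply: brot_mc.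
- exact: pt_mc.
- by move=> v v_ws; rewrite !nth_names_neq //; apply: out_w.
(* A black vertex outside may be adjacent to old white vertices of the local graph, but not to [w2],
   which is a created one. *)
- move=> d d_bs; rewrite nth_names_neq // out_b // rename_id //.
  by apply: amb_brot; rewrite ?new_w2.
Qed.

Lemma models_move m c mv : models m c -> legal mv m ->
  (mergeable mv m -> admissible (instance mv) c) /\
  models (apply_move mv m) (apply_move (instance mv) c).
Proof.
case: mv => [w1 b1 w2 b2 x1 s1 x2 s2|w b1 b2|b w1 w2].
- by move=> mod leg; have [] := models_urban mod leg.
- by move=> mod leg; have [] := models_remove_white mod leg.
- exact: models_remove_black.
Qed.

(** The base case makes the last model well formed as well, so that its circuits can be read off. *)
Fixpoint legal_run m mvs : bool :=
  if mvs is mv :: mvs' then legal mv m && legal_run (apply_move mv m) mvs'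
  else well_formed m.

Fixpoint mergeable_run m mvs : Prop :=
  if mvs is mv :: mvs' then
    mergeable mv m /\ mergeable_run (apply_move mv m) mvs'
  else True.

Lemma models_run m c mvs : models m c -> legal_run m mvs ->
  models (run m mvs) (run c [seq instance mv | mv <- mvs]).
Proof.
elim: mvs m c => //= mv mvs IHmvs m c mod /andP[leg_mv leg_mvs].
by have [_ /IHmvs] := models_move mod leg_mv; apply.
Qed.

Lemma models_admissible_run m c mvs :
  models m c -> legal_run m mvs -> mergeable_run m mvs ->
  admissible_run c [seq instance mv | mv <- mvs].
Proof.
elim: mvs m c => //= mv mvs IHmvs m c mod.
case/andP=> leg_mv leg_mvs [mer_mv mer_mvs].
have [adm mod'] := models_move mod leg_mv; split; first exact: adm.
exact: IHmvs mod' leg_mvs mer_mvs.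
Qed.

Lemma legal_run_well_formed m mvs : legal_run m mvs -> well_formed (run m mvs).
Proof. by elim: mvs m => //= mv mvs IHmvs m /andP[_ /IHmvs]. Qed.

End LocalModel.

(** * Locality and freshness in the initial graph *)

Section InitialModel.

Variables (K : fieldType) (V : vectType K) (ws bs : seq nat).
Variables (tl : nat -> seq nat) (amb c m : config V).
Hypotheses (c_bip : bipartite_graph c) (ws_uniq : uniq ws).
Hypotheses (mod : models ws bs tl amb m c) (wf : well_formed ws bs m).

(** All neighbors of a local black vertex lie in the local graph, and incidence is symmetric. *)
Lemma models_outside w b : w \notin ws -> b \in bs -> b \notin wrot c w.
Proof.
have [_ _ inc_c] := c_bip; have [_ brot_mc _ _ _] := mod.
move=> w_ws /(nthP 0)[j lt_j <-]; rewrite inc_c (cyc_eq_mem (brot_mc _ lt_j)).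
have [_ lt_ws _ _] := well_formed_brot wf lt_j.
rewrite expand_notail //; apply: contra w_ws => /mapP[i /(allP lt_ws) lt_i ->].
exact: mem_nth.
Qed.

(** A local black vertex in the block would be adjacent to [i] in the model too, hence listed twice
    around the same white vertex. *)
Lemma models_fresh_tail i l : (i < size ws)%N -> wrot m i = rcons l (size bs) ->
  fresh_tail bs (tl i).
Proof.
move=> lt_i def_i; have [uniq_w _ inc_c] := c_bip.
have [wrot_mc brot_mc _ _ _] := mod.
have := uniq_w (nth 0 ws i); rewrite (cyc_eq_uniq (wrot_mc _ lt_i)).
rewrite def_i -cats1 expand_cat expand_tail cat_uniq.
case/and3P=> _ /hasPn disj_tl tl_uniq; rewrite /fresh_tail tl_uniq.
apply/allP=> _ /(nthP 0)[j lt_j <-]; apply/negP=> j_tl.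
have /negP[] := disj_tl _ j_tl; apply: mem_expand => //.
have : nth 0 bs j \in wrot c (nth 0 ws i).
  rewrite (cyc_eq_mem (wrot_mc _ lt_i)) def_i -cats1 expand_cat expand_tail.
  by rewrite mem_cat j_tl orbT.
rewrite inc_c (cyc_eq_mem (brot_mc _ lt_j)) expand_mem //.
have [_ _ _ inc_j] := well_formed_brot wf lt_j.
move/inc_j; rewrite def_i mem_rcons inE => /orP[/eqP j_eq|//].
by rewrite j_eq ltnn in lt_j.
Qed.

End InitialModel.

Lemma generic_run_take (K : fieldType) (V : vectType K) (c : config V) mvs n :
  generic_run c mvs -> circuit_config (run c (take n mvs)).
Proof.
elim: mvs c n => [|mv mvs IHmvs] c n /= []; first by [].
by case: n => [//|n] _ [_ gen]; apply: IHmvs.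
Qed.

(** * Circuits in terms of dimensions of spans *)

Section Circuits.

Variables (K : fieldType) (V : vectType K).
Implicit Types (U W : {vspace V}) (s t : seq {vspace V}).

Lemma vpickK U : \dim U = 1%N -> <[vpick U]>%VS = U.
Proof.
move=> dimU; apply/eqP; rewrite eqEdim -memvE memv_pick dim_vline dimU.
by rewrite vpick0 -dimv_eq0 dimU.
Qed.

Lemma independentE s : all (fun U => \dim U == 1%N) s ->
  independent s = (\dim (\sum_(U <- s) U) == size s).
Proof.
move=> /allP dim_s; rewrite /independent /free size_map span_def big_map.
congr (\dim _ == _); rewrite big_seq [RHS]big_seq.
by apply: eq_bigr => U /dim_s /eqP /vpickK.
Qed.

(** The other points are independent, being a proper subset, and the dependence of all of [s] means
    that adding [U] does not raise the dimension. The permutation lets any point of the circuit play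
    [U]. *)
Lemma circuit_span s U t :
  circuit s -> all (fun W => \dim W == 1%N) s -> perm_eq s (U :: t) ->
  \dim (\sum_(W <- t) W) = size t /\ (U <= \sum_(W <- t) W)%VS.
Proof.
case=> dep_s indep_s dim_s s_t; have := dim_s.
rewrite (perm_all _ s_t) /= => /andP[/eqP dimU dim_t].
have U_s : U \in s by rewrite (perm_mem s_t) mem_head.
have t_rem : perm_eq (rem U s) t.
  rewrite -(perm_cons U); apply: perm_trans s_t.
  by rewrite perm_sym perm_to_rem.
have dim_sum_t : \dim (\sum_(W <- t) W) = size t.
  have := indep_s _ (rem_subseq U s); rewrite independentE.
    rewrite (perm_big _ t_rem) (perm_size t_rem) (perm_size s_t) /=.
    by move/(_ (ltnSn _)) => /eqP.
  by rewrite (perm_all _ t_rem).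
split=> //; move: dep_s.
rewrite independentE // (perm_big _ s_t) (perm_size s_t) /=.
rewrite big_cons => dim_neq.
suff /eqP-> : (\sum_(W <- t) W == U + \sum_(W <- t) W)%VS by apply: addvSl.
rewrite eqEdim addvSr /= dim_sum_t -ltnS ltn_neqAle dim_neq /=.
by rewrite -dim_sum_t -add1n -dimU dimv_add_leqif.
Qed.

End Circuits.

(** * Circuits read off a model *)

Section ModelCircuits.

Variables (K : fieldType) (V : vectType K).
Variables (ws bs : seq nat) (tl : nat -> seq nat) (amb : config V).

Lemma models_circuit (m c : config V) j x t :
  models ws bs tl amb m c -> well_formed ws bs m -> circuit_config c ->
  (j < size bs)%N -> perm_eq (brot m j) (x :: t) ->
  [/\ \dim (pt m x) = 1%N, \dim (\sum_(w <- t) pt m w)%VS = size t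
    & (pt m x <= \sum_(w <- t) pt m w)%VS].
Proof.
move=> [wrot_mc brot_mc pt_mc _ _] wf [dim_c circ_c] lt_j j_t.
have [_ lt_ws _ inc_j] := well_formed_brot wf lt_j.
(* The dimension is known only at vertices with a neighbor; here [j] is one. *)
have dim_pt w : w \in brot m j -> \dim (pt m w) = 1%N.
  move=> w_j; have /= lt_w := allP lt_ws w w_j.
  rewrite -pt_mc //; apply: dim_c.
  have := mem_expand (tl w) lt_j (inc_j _ w_j).
  by rewrite -(cyc_eq_mem (wrot_mc _ lt_w)); case: (wrot c _).
have pts : perm_eq [seq pt c w | w <- brot c (nth 0 bs j)]
                   (pt m x :: [seq pt m w | w <- t]).
  have := perm_map (pt c) (cyc_eq_perm (brot_mc _ lt_j)).
  rewrite expand_notail // -map_comp => /perm_trans; apply.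
  rewrite -[_ :: _]/(map (pt m) (x :: t)).
  have /eq_in_map-> : {in brot m j, pt c \o nth 0 ws =1 pt m}.
    by move=> w /(allP lt_ws) lt_w /=; rewrite pt_mc.
  exact: perm_map.
have dim_all : all (fun W => \dim W == 1%N)
    [seq pt c w | w <- brot c (nth 0 bs j)].
  rewrite (perm_all _ pts) -[_ :: _]/(map (pt m) (x :: t)).
  by apply/allP=> _ /mapP[w w_t ->]; rewrite dim_pt // (perm_mem j_t).
have circ_j : circuit [seq pt c w | w <- brot c (nth 0 bs j)].
  apply: circ_c; apply/negP=> /eqP brot0; move: pts.
  by rewrite brot0 => /perm_size.
have [] := circuit_span circ_j dim_all pts.
rewrite big_map size_map => -> ->; split=> //.
by apply: dim_pt; rewrite (perm_mem j_t) mem_head.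
Qed.

End ModelCircuits.

(** * Intersections of the three planes through the last vertex *)

Section CubeGeometry.

Variables (K : fieldType) (V : vectType K).
Implicit Types (U W : {vspace V}).

Lemma dimv_cap_leq U W (n : nat) :
  (n <= \dim (U + W))%N -> (\dim (U :&: W) <= \dim U + \dim W - n)%N.
Proof.
move=> le_n; rewrite -(dimv_sum_cap U W).
by rewrite -addnBAC // leq_addl.
Qed.

Variables A B C A' B' C' : {vspace V}.
Variables E F G X Y : {vspace V}.

Let H1 := (A + B' + C')%VS.
Let H2 := (A' + B + C')%VS.
Let H3 := (A' + B' + C)%VS.

Hypotheses (dim_A : \dim A = 1%N) (dim_B : \dim B = 1%N).
Hypotheses (dim_A' : \dim A' = 1%N) (dim_B' : \dim B' = 1%N).
Hypothesis le_G : (G <= A' + B)%VS.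
Hypotheses (le_F : (F <= A' + B)%VS) (le_E : (E <= A + B')%VS).
Hypotheses (dim_ABC'G : \dim (A + B + C' + G)%VS = 4).
Hypotheses (dim_A'B'CE : \dim (A' + B' + C + E)%VS = 4).
Hypotheses (dim_E : \dim E = 1%N) (dim_F : \dim F = 1%N).
Hypothesis dim_EF : \dim (E + F)%VS = 2.
Hypotheses (le_EF : (E <= C' + F)%VS) (le_FE : (F <= C' + E)%VS).
Hypotheses (dim_H1 : \dim H1 = 3) (dim_H2 : \dim H2 = 3) (dim_H3 : \dim H3 = 3).
(* X is the point produced by the moves, Y that of the Q-net. *)
Hypotheses (dim_X : \dim X = 1%N) (dim_C'X : \dim (C' + X)%VS = 2).
Hypotheses (X1 : (X <= H1)%VS) (X2 : (X <= H2)%VS) (X3 : (X <= H3)%VS).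
Hypotheses (dim_Y : \dim Y = 1%N).
Hypotheses (Y1 : (Y <= H1)%VS) (Y2 : (Y <= H2)%VS) (Y3 : (Y <= H3)%VS).

Local Ltac summand :=
  solve [ assumption | exact: subvv
        | apply: subv_trans (addvSl _ _); summand
        | apply: subv_trans (addvSr _ _); summand ].
Local Ltac sum_sub := rewrite ?subv_add -?andbA; repeat (apply/andP; split);
  try summand.

(* H1 + H2 contains A, B, C' and G, hence has dimension at least 4. *)
Lemma cap_H1_H2 : (H1 :&: H2 = E + F)%VS.
Proof.
have le_AB' : (A + B' <= H1)%VS by sum_sub.
have le_A'B : (A' + B <= H2)%VS by sum_sub.
have le_EH1 := subv_trans le_E le_AB'; have le_FH2 := subv_trans le_F le_A'B.
have le_EF12 : (E + F <= H1 :&: H2)%VS.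
  rewrite subv_cap; apply/andP; split; sum_sub.
    by apply: subv_trans le_FE _; sum_sub.
  by apply: subv_trans le_EF _; sum_sub.
have dim_H12 : (4 <= \dim (H1 + H2))%N.
  rewrite -dim_ABC'G; apply: dimvS; rewrite /H1 /H2; sum_sub.
apply/eqP; rewrite eq_sym eqEdim le_EF12 dim_EF.
by have := dimv_cap_leq dim_H12; rewrite dim_H1 dim_H2.
Qed.

(** Both C' and X lie in H1 and H2, hence on their common line EF; the dimensions agree. *)
Lemma cap_C'X : (C' + X = E + F)%VS.
Proof.
apply/eqP; rewrite eqEdim dim_C'X dim_EF leqnn andbT -cap_H1_H2 subv_cap.
by apply/andP; split; rewrite /H1 /H2; sum_sub.
Qed.

(** A', B', C and E are independent, so E is not in H3 and the line EF meets this plane in at most a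
    point. *)
Lemma dim_cap_H123 : (\dim (H1 :&: H2 :&: H3) <= 1)%N.
Proof.
have dim_EFH3 : (4 <= \dim (E + F + H3))%N.
  by rewrite -dim_A'B'CE; apply: dimvS; rewrite /H3; sum_sub.
by have := dimv_cap_leq dim_EFH3; rewrite cap_H1_H2 dim_H3 dim_EF.
Qed.

Lemma le1_cap_H123 U : \dim U = 1%N ->
  (U <= H1)%VS -> (U <= H2)%VS -> (U <= H3)%VS -> (H1 :&: H2 :&: H3 = U)%VS.
Proof.
move=> dim_U U1 U2 U3; apply/eqP; rewrite eq_sym eqEdim dim_U dim_cap_H123.
by rewrite !subv_cap U1 U2 U3.
Qed.

Lemma cap_H123 : (H1 :&: H2 :&: H3 = Y)%VS.
Proof. exact: le1_cap_H123. Qed.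

Lemma X_eq_Y : X = Y.
Proof. by rewrite -(le1_cap_H123 dim_X X1 X2 X3) cap_H123. Qed.

(** The lines C'Y and EF coincide. As W, W', C' span a plane, this line differs from WW' and meets
    it in at most a point, while [U] is on both. It serves for F on A'B and for E on AB'. *)
Lemma point_eq_cap U W W' : \dim U = 1%N -> \dim W = 1%N -> \dim W' = 1%N ->
  \dim (W + W' + C')%VS = 3 -> (U <= E + F)%VS -> (U <= W + W')%VS ->
  (U = (C' + Y) :&: (W + W'))%VS.
Proof.
move=> dim_U dim_W dim_W' dim_WW'C' le_UEF le_UW.
have dim_WW' : (\dim (W + W') <= 2)%N.
  by have := dimv_add_leqif W W'; rewrite dim_W dim_W' => -[].
have dim_sum : (3 <= \dim (C' + X + (W + W')))%N.
  by rewrite -dim_WW'C'; apply: dimvS; sum_sub.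
apply/eqP; rewrite eqEdim dim_U -X_eq_Y subv_cap le_UW cap_C'X le_UEF /=.
rewrite -cap_C'X; apply: leq_trans (dimv_cap_leq dim_sum) _.
by rewrite dim_C'X leq_subLR !add2n !ltnS.
Qed.

Lemma cube_geometry :
  [/\ X = Y, F = ((C' + Y) :&: (A' + B))%VS, E = ((C' + Y) :&: (A + B'))%VS
    & (H1 :&: H2 :&: H3 = Y)%VS].
Proof.
split; [exact: X_eq_Y | | | exact: cap_H123].
  by apply: point_eq_cap; rewrite ?addvSr.
by apply: point_eq_cap; rewrite ?addvSl.
Qed.

End CubeGeometry.

(** * The concrete cube and its initial embedding *)

Section Cube.

Variables (K : fieldType) (V : vectType K).

(* The white vertices are numbered in the order
   D, A, B, C, A', B', C', G, H, F, A'', B'', E, C'', D',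
   the black ones in the order a', b', c', s1, t1, s2, t2, s3, t3, s4, t4. *)
Definition cube_model (p : nat -> {vspace V}) := Config
  (nth [::] [:: [:: 0; 1; 2]; [:: 2; 1; 11]; [:: 0; 2; 11]; [:: 1; 0; 11];
                [:: 0; 11]; [:: 1; 11]; [:: 2; 11]])
  (nth [::] [:: [:: 0; 2; 4; 3]; [:: 0; 3; 5; 1]; [:: 0; 1; 6; 2]]) p.

(** Moves (i) to (v) by indices; [instance] turns them into the moves on actual names. *)
Definition cube_moves := [::
  Urban 3 0 0 1 7 3 8 4; RemoveWhite 0 2 4;
  Urban 2 2 7 0 9 5 10 6; RemoveBlack 0 4 10;
  Urban 1 1 8 2 11 7 12 8; RemoveBlack 1 5 11;
  RemoveWhite 7 3 6; RemoveWhite 8 3 8;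
  Urban 9 2 12 3 13 9 14 10; RemoveBlack 2 6 13;
  RemoveWhite 12 7 10; RemoveWhite 9 5 9].

(** Legality never looks at the points [p], so each of the 13 prefixes is checked by evaluation. *)
Lemma legal_cube_moves n ws bs p : size ws = 15 -> size bs = 11 ->
  (n <= 12)%N -> legal_run ws bs 7 (cube_model p) (take n cube_moves).
Proof.
move=> sz_ws sz_bs; rewrite /legal_run /legal /well_formed.
rewrite sz_ws sz_bs.
by do 13 (case: n => [|n]; first by []).
Qed.

Section InitialCube.

Variables (c : config V) (A B C A' B' C' D a' b' c' : nat).
Variables (out : nat -> seq nat).
Hypotheses (c_bip : bipartite_graph c).
Hypothesis (c_star : star c D A B C A' B' C' a' b' c' out).
Variables (G H F A'' B'' E C'' D' s1 t1 s2 t2 s3 t3 s4 t4 : nat).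
Hypothesis white_uniq : uniq [:: G; H; F; A''; B''; E; C''; D'].
Hypothesis white_new :
  forall w, w \in [:: G; H; F; A''; B''; E; C''; D'] -> wrot c w = [::].
Hypothesis black_uniq : uniq [:: s1; t1; s2; t2; s3; t3; s4; t4].
Hypothesis black_new :
  forall b, b \in [:: s1; t1; s2; t2; s3; t3; s4; t4] -> brot c b = [::].

Let ws := [:: D; A; B; C; A'; B'; C'; G; H; F; A''; B''; E; C''; D'].
Let bs := [:: a'; b'; c'; s1; t1; s2; t2; s3; t3; s4; t4].
Let tl := nth [::] [:: [::]; out A; out B; out C; out A'; out B'; out C'].
Let m := cube_model (fun i => pt c (nth 0 ws i)).

(** Old names have neighbors and new ones have none, so they cannot coincide. *)
Lemma cube_ws_uniq : uniq ws.
Proof.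
case: c_star => -[old_uniq _] cD _ [cA cB cC] [cA' cB' cC'].
rewrite -[ws]/([:: D; A; B; C; A'; B'; C'] ++
                [:: G; H; F; A''; B''; E; C''; D']).
rewrite cat_uniq old_uniq white_uniq andbT andTb.
apply/hasPn=> w /white_new w_nil; apply/negP=> w_old.
suff: wrot c w != [::] by rewrite w_nil.
by move: w_old; rewrite !inE => /or4P[|||/or4P[]] /eqP->;
   apply: cyc_eq_cons_neq0; eassumption.
Qed.

Lemma cube_bs_uniq : uniq bs.
Proof.
case: c_star => -[_ old_uniq] _ [ca' cb' cc'] _ _.
rewrite -[bs]/([:: a'; b'; c'] ++ [:: s1; t1; s2; t2; s3; t3; s4; t4]).
rewrite cat_uniq old_uniq black_uniq andbT andTb.
apply/hasPn=> b /black_new b_nil; apply/negP=> b_old.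
suff: brot c b != [::] by rewrite b_nil.
by move: b_old; rewrite !inE => /or3P[] /eqP->;
   apply: cyc_eq_cons_neq0; eassumption.
Qed.

(** [star] gives the orders at old names. Beyond them [nth] defaults to the empty list, which agrees
    with new names having no neighbors yet. *)
Lemma cube_models : models ws bs tl c m c.
Proof.
case: c_star => _ cD [ca' cb' cc'] [cA cB cC] [cA' cB' cC'].
split=> // [i lt_i|j lt_j].
  do 7 (case: i lt_i => [_|i lt_i]; first by rewrite /expand /= ?cats0).
  rewrite [wrot m _]nth_default //=; apply/cyc_eq_nil/white_new.
  by rewrite -[nth _ _ _]/(nth 0 (drop 7 ws) i) mem_nth.
do 3 (case: j lt_j => [_|j lt_j]; first by rewrite /expand /= ?cats0).
rewrite [brot m _]nth_default //=; apply/cyc_eq_nil/black_new.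
by rewrite -[nth _ _ _]/(nth 0 (drop 3 bs) j) mem_nth.
Qed.

Lemma cube_well_formed : well_formed ws bs m.
Proof.
have := legal_cube_moves (fun i => pt c (nth 0 ws i)) (ws := ws) (bs := bs).
by move/(_ 0 erefl erefl isT).
Qed.

Lemma cube_fresh_tail i : (i < size ws)%N -> fresh_tail bs (tl i).
Proof.
have fresh := models_fresh_tail c_bip cube_ws_uniq cube_models cube_well_formed.
case: i => [_|[_|[_|[_|[_|[_|[_|i _]]]]]]]; last first.
  by rewrite [tl _]nth_default //; apply: nil_fresh.
- exact: (fresh 6 [:: 2]).
- exact: (fresh 5 [:: 1]).
- exact: (fresh 4 [:: 0]).
- exact: (fresh 3 [:: 1; 0]).
- exact: (fresh 2 [:: 0; 2]).
- exact: (fresh 1 [:: 2; 1]).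
- exact: nil_fresh.
Qed.

Lemma cube_outside_white w b : w \notin ws -> b \in bs -> b \notin wrot c w.
Proof. exact: (models_outside c_bip cube_models cube_well_formed). Qed.

Lemma cube_outside_black b i :
  (7 <= i < size ws)%N -> nth 0 ws i \notin brot c b.
Proof.
have [_ _ inc_c] := c_bip => /andP[le_i lt_i].
by rewrite -inc_c (models_wrot_nil cube_models) //; apply: nth_default.
Qed.

End InitialCube.

End Cube.

(** * Points and circuits along the run *)

Definition created (mv : move) :=
  if mv is Urban _ _ _ _ x1 _ x2 _ then [:: x1; x2] else [::].

Lemma pt_run (K : fieldType) (V : vectType K) (c : config V) mvs w :
  all (fun mv => w \notin created mv) mvs -> pt (run c mvs) w = pt c w.
Proof.
elim: mvs c => //= mv mvs IHmvs c /andP[w_mv w_mvs].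
rewrite IHmvs //; case: mv w_mv => //= w1 b1 w2 b2 x1 s1 x2 s2.
by rewrite !inE negb_or => /andP[/negPf-> /negPf->].
Qed.

Section CubeRun.

Variables (K : fieldType) (V : vectType K) (ws bs : seq nat).
Variables (tl : nat -> seq nat) (amb c : config V) (p : nat -> {vspace V}).
Hypotheses (size_ws : size ws = 15) (size_bs : size bs = 11).
Hypotheses (ws_uniq : uniq ws) (bs_uniq : uniq bs).
Hypothesis tl_fresh : forall i, (i < size ws)%N -> fresh_tail bs (tl i).
Hypothesis amb_wrot :
  forall w b, w \notin ws -> b \in bs -> b \notin wrot amb w.
Hypothesis amb_brot : forall b i, b \notin bs -> (7 <= i < size ws)%N ->
  nth 0 ws i \notin brot amb b.
Hypothesis mod : models ws bs tl amb (cube_model p) c.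

Let ms := [seq instance ws bs mv | mv <- cube_moves].
Let m n := run (cube_model p) (take n cube_moves).
Hypothesis gen : generic_run c ms.

Lemma models_stage n : (n <= 12)%N ->
  models ws bs tl amb (m n) (run c (take n ms)).
Proof.
move=> le_n; rewrite /ms -map_take.
by apply: models_run (legal_cube_moves _ _ _ _) => //; exact: mod.
Qed.

Variable q : nat -> {vspace V}.
Hypothesis def_q : q = pt (m 12).

(* The point at i is not changed by the moves following the n-th one. *)
Let settled n i := all (fun mv => i \notin created mv) (drop n cube_moves).

(** Circuits met at different stages can thus all be stated with the single assignment [q] of final
    points, which also remembers removed vertices. *)
Lemma pt_settled n i : settled n i -> pt (m n) i = q i.
Proof.
move=> new_i; rewrite def_q.
have -> : m 12 = run (m n) (drop n cube_moves).
  by rewrite /m /run -foldl_cat cat_take_drop take_oversize.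
by rewrite pt_run.
Qed.

(** The form in which genericity is used. On concrete arguments the side conditions hold by
    evaluation. *)
Lemma circuit_stage n j x t : (n <= 12)%N -> (j < 11)%N ->
  perm_eq (brot (m n) j) (x :: t) -> all (settled n) (x :: t) ->
  [/\ \dim (q x) = 1%N, \dim (\sum_(w <- t) q w)%VS = size t
    & (q x <= \sum_(w <- t) q w)%VS].
Proof.
move=> le_n lt_j j_t /= /andP[set_x /allP set_t].
have sum_t : (\sum_(w <- t) pt (m n) w = \sum_(w <- t) q w)%VS.
  by apply: eq_big_seq => w /set_t /pt_settled.
rewrite -(pt_settled set_x) -sum_t.
apply: models_circuit (models_stage le_n) _ _ _ j_t.
- exact: legal_run_well_formed (legal_cube_moves _ _ _ _).
- exact: generic_run_take.
- by rewrite size_bs.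
Qed.

Lemma face_point_stage n w1 b1 w2 b2 x1 s1 x2 s2 :
  ohead (drop n cube_moves) = Some (Urban w1 b1 w2 b2 x1 s1 x2 s2) ->
  x1 != x2 -> all (settled n) [:: w1; w2] -> all (settled n.+1) [:: x1; x2] ->
  all (settled n) (brot (m n) b1) -> all (settled n) (brot (m n) b2) ->
  q x1 = ((q w1 + q w2) :&:
    \sum_(w <- brot (m n) b1 | w \notin [:: w1; w2]) q w)%VS /\
  q x2 = ((q w1 + q w2) :&:
    \sum_(w <- brot (m n) b2 | w \notin [:: w1; w2]) q w)%VS.
Proof.
move=> nth_n x12 /and3P[set_w1 set_w2 _] /and3P[set_x1 set_x2 _].
move=> /allP set_b1 /allP set_b2.
rewrite -(pt_settled set_x1) -(pt_settled set_x2).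
have -> : m n.+1 = apply_move (Urban w1 b1 w2 b2 x1 s1 x2 s2) (m n).
  rewrite /m; case: (ltnP n 12) => [lt_n|le_n]; last first.
    by rewrite drop_oversize in nth_n.
  (* The default move is never reached, since [n] is less than 12. *)
  rewrite (take_nth (RemoveWhite 0 0 0)) // {1}/run foldl_rcons.
  by move: nth_n; rewrite (drop_nth (RemoveWhite 0 0 0)) //= => -[->].
rewrite /= !eqxx [x2 == x1]eq_sym (negPf x12) /face_point !pt_settled //.
by split; congr (_ :&: _)%VS; rewrite big_seq_cond [RHS]big_seq_cond;
   apply: eq_bigr => w /andP[w_b _]; apply: pt_settled;
   [apply: set_b1 | apply: set_b2].
Qed.

Lemma pt_G : q 7 = ((q 4 + q 2) :&: (q 3 + q 0))%VS.
Proof.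
have [//|//|//|//|//|//|-> _] := @face_point_stage 0 3 0 0 1 7 3 8 4.
rewrite -[brot _ _]/[:: 0; 2; 4; 3] !big_cons big_nil /= addv0 capvC.
by rewrite [(q 2 + _)%VS]addvC.
Qed.

Lemma pt_H : q 8 = ((q 1 + q 5) :&: (q 3 + q 0))%VS.
Proof.
have [//|//|//|//|//|//|_ ->] := @face_point_stage 0 3 0 0 1 7 3 8 4.
by rewrite -[brot _ _]/[:: 0; 3; 5; 1] !big_cons big_nil /= addv0 capvC addvC.
Qed.

(** After (i), a' has only the neighbors G, B, A', so A'' is the intersection of the line BG with
    A'. The circuit at a' puts A' on this line. The same argument at b' gives B'' below. *)
Lemma pt_F_A'' : (q 9 <= q 2 + q 7)%VS /\ q 10 = q 4.
Proof.
have [//|//|//|//|//|//|-> ->] := @face_point_stage 2 2 2 7 0 9 5 10 6.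
split; first exact: capvSl.
rewrite -[brot _ _]/[:: 7; 2; 4] !big_cons big_nil /= addv0.
have [//|//|//|//|_ _] := @circuit_stage 1 0 4 [:: 2; 7].
by rewrite !big_cons big_nil addv0 => /capv_idPr.
Qed.

Lemma pt_E_B'' : (q 12 <= q 1 + q 8)%VS /\ q 11 = q 5.
Proof.
have [//|//|//|//|//|//|-> ->] := @face_point_stage 4 1 1 8 2 11 7 12 8.
split; first exact: capvSl.
rewrite -[brot _ _]/[:: 8; 5; 1] !big_cons big_nil /= addv0.
have [//|//|//|//|_ _] := @circuit_stage 1 1 5 [:: 1; 8].
by rewrite !big_cons big_nil addv0 => /capv_idPr.
Qed.

(** After (iii), c' has only the neighbors E, C', F, and their circuit puts C' on the line EF. *)
Lemma pt_C'' : q 13 = q 6.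
Proof.
have [//|//|//|//|//|//|-> _] := @face_point_stage 8 9 2 12 3 13 9 14 10.
rewrite -[brot _ _]/[:: 12; 6; 9] !big_cons big_nil /= addv0.
have [//|//|//|//|_ _] := @circuit_stage 6 2 6 [:: 9; 12].
by rewrite !big_cons big_nil addv0 => /capv_idPr.
Qed.

Lemma le_F : (q 9 <= q 4 + q 2)%VS.
Proof.
have [q9_le _] := pt_F_A''; apply: subv_trans q9_le _.
by rewrite subv_add addvSr pt_G capvSl.
Qed.

Lemma le_E : (q 12 <= q 1 + q 5)%VS.
Proof.
have [q12_le _] := pt_E_B''; apply: subv_trans q12_le _.
by rewrite subv_add addvSl pt_H capvSl.
Qed.

Lemma dim_cube_points :
  [/\ \dim (q 1) = 1%N, \dim (q 2) = 1%N, \dim (q 4) = 1%N, \dim (q 5) = 1%N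
    & \dim (q 14) = 1%N].
Proof.
have [//|//|//|//|d1 _ _] := @circuit_stage 12 7 1 [:: 5; 6; 14].
have [//|//|//|//|d2 _ _] := @circuit_stage 12 5 2 [:: 4; 6; 14].
have [//|//|//|//|d4 _ _] := @circuit_stage 12 3 4 [:: 3; 5; 14].
have [//|//|//|//|d5 _ _] := @circuit_stage 12 3 5 [:: 3; 4; 14].
by have [//|//|//|//|d14 _ _] := @circuit_stage 12 3 14 [:: 3; 4; 5].
Qed.

(** Any three points of a circuit of four are independent; the circuits are those around D' at the
    end of the run. *)
Lemma dim_opposite_planes :
  [/\ \dim (q 1 + q 5 + q 6)%VS = 3, \dim (q 4 + q 2 + q 6)%VS = 3
    & \dim (q 4 + q 5 + q 3)%VS = 3].
Proof.
have [//|//|//|//|_ d1 _] := @circuit_stage 12 7 14 [:: 1; 5; 6].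
have [//|//|//|//|_ d2 _] := @circuit_stage 12 5 14 [:: 4; 2; 6].
have [//|//|//|//|_ d3 _] := @circuit_stage 12 3 14 [:: 4; 5; 3].
by move: d1 d2 d3; rewrite !big_cons big_nil !addv0 !addvA.
Qed.

Variable Y : {vspace V}.
Hypotheses (dim_Y : \dim Y = 1%N).
Hypotheses (Y1 : (Y <= q 1 + q 5 + q 6)%VS) (Y2 : (Y <= q 4 + q 2 + q 6)%VS).
Hypotheses (Y3 : (Y <= q 4 + q 5 + q 3)%VS).

Lemma cube_points :
  [/\ q 14 = Y,
    q 9 = ((q 6 + Y) :&: (q 4 + q 2))%VS, q 12 = ((q 6 + Y) :&: (q 1 + q 5))%VS
  & ((q 1 + q 5 + q 6) :&: (q 4 + q 2 + q 6) :&: (q 4 + q 5 + q 3))%VS = Y].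
Proof.
have [dA dB dA' dB' dX] := dim_cube_points.
have [d1 d2 d3] := dim_opposite_planes.
have le_G : (q 7 <= q 4 + q 2)%VS by rewrite pt_G capvSl.
(* The circuits used are A, B, C', G, H at c' after (i), then F, A', B', C, E at s1 after (iv), and
   C', E, F at c' after (iii). The first two give four independent points each, by omitting H and F
   respectively. *)
have [//|//|//|//|_ dABC'G _] := @circuit_stage 2 2 8 [:: 1; 2; 6; 7].
have [//|//|//|//|_ dA'B'CE _] := @circuit_stage 8 3 9 [:: 4; 5; 3; 12].
have [//|//|//|//|_ dEF _] := @circuit_stage 6 2 6 [:: 12; 9].
have [//|//|//|//|dE _ le_EF] := @circuit_stage 6 2 12 [:: 6; 9].
have [//|//|//|//|dF _ le_FE] := @circuit_stage 6 2 9 [:: 6; 12].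
have [//|//|//|//|_ _ X1] := @circuit_stage 12 7 14 [:: 1; 5; 6].
have [//|//|//|//|_ _ X2] := @circuit_stage 12 5 14 [:: 4; 2; 6].
have [//|//|//|//|_ _ X3] := @circuit_stage 12 3 14 [:: 4; 5; 3].
have [//|//|//|//|_ dB'C'X _] := @circuit_stage 12 7 1 [:: 5; 6; 14].
have [//|//|//|//|dC' _ _] := @circuit_stage 12 7 6 [:: 1; 5; 14].
rewrite !big_cons big_nil !addv0 in dABC'G dA'B'CE dEF le_EF le_FE.
rewrite !big_cons big_nil !addv0 in X1 X2 X3 dB'C'X.
rewrite !addvA in dABC'G dA'B'CE X1 X2 X3.
(* Two points span at most a line; the lower bound comes from the independence of B', C', D'. *)
have dC'X : \dim (q 6 + q 14)%VS = 2.
  apply/eqP; rewrite eqn_leq; apply/andP; split.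
    by have [] := dimv_add_leqif (q 6) (q 14); rewrite dX dC'.
  have [] := dimv_add_leqif (q 5) (q 6 + q 14)%VS.
  by rewrite dB' dB'C'X add1n ltnS.
have leF := le_F; have leE := le_E.
by apply: (@cube_geometry _ _ (q 1) (q 2) (q 3) (q 4) (q 5) (q 6)
                          (q 12) (q 9) (q 7)).
Qed.

Lemma pt_stage n i : (n <= 12)%N -> (i < 15)%N -> settled n i ->
  pt (run c (take n ms)) (nth 0 ws i) = q i.
Proof.
move=> le_n lt_i set_i; rewrite -(pt_settled set_i).
by have [_ _ -> //] := models_stage le_n; rewrite size_ws.
Qed.

(** Only the three removals of black vertices carry a condition: that A'', B'', C'' coincide with
    A', B', C'. *)
Lemma mergeable_cube_moves : mergeable_run (cube_model p) cube_moves.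
Proof.
have [_ q10] := pt_F_A''; have [_ q11] := pt_E_B''; have q13 := pt_C''.
have merge_A : pt (m 3) 4 = pt (m 3) 10 by rewrite !pt_settled.
have merge_B : pt (m 5) 5 = pt (m 5) 11 by rewrite !pt_settled.
have merge_C : pt (m 9) 6 = pt (m 9) 13 by rewrite !pt_settled.
by do !split.
Qed.

End CubeRun.

(** * Coplanar points and faces of the Q-net *)

Section Coplanarity.

Variable R : realType.
Implicit Types (U W : {vspace 'rV[R]_4}) (s : seq {vspace 'rV[R]_4}).

Lemma dim_homog (p : 'rV[R]_3) : \dim (homog p) = 1%N.
Proof.
rewrite dim_vline; suff -> : row_mx p (1%:M : 'M[R]_1) != 0%R by [].
by rewrite row_mx_eq0 negb_and oner_neq0 orbT.
Qed.

(** This lets a face of the Q-net be quoted in any order of its points; [l] lists positions in the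
    order of [Qnet]. *)
Lemma coplanar_nth s (l : seq nat) : coplanar s -> all (gtn (size s)) l ->
  coplanar [seq nth 0%VS s n | n <- l].
Proof.
case=> W dim_W W_s /allP lt_l; exists W => // _ /mapP[n /lt_l lt_n ->].
by apply: W_s; apply: mem_nth.
Qed.

(** Three independent points already span the common plane. *)
Lemma coplanar_sub U1 U2 U3 W : coplanar [:: U1; U2; U3; W] ->
  \dim (U1 + U2 + U3) = 3%N -> (W <= U1 + U2 + U3)%VS.
Proof.
case=> P dim_P P_s dim_U.
have /eqP-> : (U1 + U2 + U3 == P)%VS.
  by rewrite eqEdim dim_U dim_P leqnn !subv_add !P_s ?inE ?eqxx ?orbT.
by apply: P_s; rewrite !inE eqxx !orbT.
Qed.

End Coplanarity.

(** * The time evolution step *)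

Local Open Scope ring_scope.

Theorem proposition4p9 (R : realType)
    (* the Q-net, and one of its elementary cubes *)
    (f : 'rV[int]_3 -> 'rV[R]_3) (hf : Qnet f)
    (u : 'rV[int]_3) (i j k : 'I_3) (hijk : uniq [:: i; j; k])
    (* a planar graph containing the local graph *)
    (c : config 'rV[R]_4) (hc : bipartite_graph c) (hplanar : planar c)
    (A B C A' B' C' D a' b' c' : nat) (out : nat -> seq nat)
    (hstar : star c D A B C A' B' C' a' b' c' out)
    (hD : pt c D = homog (f u))
    (hA : pt c A = homog (f (u + unit_step i)))
    (hB : pt c B = homog (f (u + unit_step j)))
    (hC : pt c C = homog (f (u + unit_step k)))
    (hA' : pt c A' = homog (f (u + unit_step j + unit_step k)))
    (hB' : pt c B' = homog (f (u + unit_step i + unit_step k)))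
    (hC' : pt c C' = homog (f (u + unit_step i + unit_step j)))
    (* names of the vertices to be created; A'', B'', C'' are to be merged with
       A', B', C' *)
    (G H F A'' B'' E C'' D' : nat)
    (hwhite_uniq : uniq [:: G; H; F; A''; B''; E; C''; D'])
    (hwhite_new : forall w, w \in [:: G; H; F; A''; B''; E; C''; D'] ->
       wrot c w = [::])
    (s1 t1 s2 t2 s3 t3 s4 t4 : nat)
    (hblack_uniq : uniq [:: s1; t1; s2; t2; s3; t3; s4; t4])
    (hblack_new : forall b, b \in [:: s1; t1; s2; t2; s3; t3; s4; t4] ->
       brot c b = [::]) :
  let ms := [::
    (* (i) *)
    Urban C a' D b' G s1 H t1; RemoveWhite D c' t1;
    (* (ii) *)
    Urban B c' G a' F s2 A'' t2; RemoveBlack a' A' A'';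
    (* (iii) *)
    Urban A b' H c' B'' s3 E t3; RemoveBlack b' B' B'';
    (* (iv) *)
    RemoveWhite G s1 t2; RemoveWhite H s1 t3;
    (* (v) *)
    Urban F c' E s1 C'' s4 D' t4; RemoveBlack c' C' C'';
    RemoveWhite E s3 t4; RemoveWhite F s2 s4] in
  let P := pt c in
  let PD' := homog (f (u + unit_step i + unit_step j + unit_step k)) in
  let r := run c ms in
  generic_run c ms ->
  [/\
    (* the six faces of the cube *)
    [/\ coplanar [:: P A'; P B; P D; P C], coplanar [:: P A; P B'; P C; P D]
      & coplanar [:: P A; P D; P B; P C']] /\
    [/\ coplanar [:: P A; P B'; PD'; P C'], coplanar [:: P A'; P B; P C'; PD']
      & coplanar [:: P B'; P C; P A'; PD']],
    (* the moves can be performed *)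
    admissible_run c ms,
    (* the intermediate points *)
    [/\ pt (run c (take 1 ms)) G = ((P A' + P B) :&: (P C + P D))%VS,
        pt (run c (take 1 ms)) H = ((P A + P B') :&: (P C + P D))%VS,
        pt (run c (take 3 ms)) F = ((P C' + PD') :&: (P A' + P B))%VS
      & pt (run c (take 5 ms)) E = ((P C' + PD') :&: (P A + P B'))%VS],
    (* the resulting graph and its points *)
    [/\ star r D' A' B' C' A B C s3 s2 s1 out,
        (forall w, w \notin [:: A; B; C; A'; B'; C'; D; D'] ->
           wrot r w = wrot c w) /\ wrot r D = [::],
        (forall b, b \notin [:: a'; b'; c'; s1; s2; s3] ->
           brot r b = brot c b) /\
        (forall b, b \in [:: a'; b'; c'] -> brot r b = [::]),
        pt r D' = PD'
      & forall w, wrot r w != [::] -> w != D' -> pt r w = P w]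
    (* time evolution of the Q-net *)
  & [/\ \dim (P A + P B' + P C')%VS = 3%N, \dim (P A' + P B + P C')%VS = 3%N,
        \dim (P A' + P B' + P C)%VS = 3%N
      & ((P A + P B' + P C') :&: (P A' + P B + P C') :&: (P A' + P B' + P C))%VS
        = PD']].
Proof.
move=> ms P PD' r gen.
pose ws := [:: D; A; B; C; A'; B'; C'; G; H; F; A''; B''; E; C''; D'].
pose bs := [:: a'; b'; c'; s1; t1; s2; t2; s3; t3; s4; t4].
pose tl := nth [::] [:: [::]; out A; out B; out C; out A'; out B'; out C'].
pose p i := pt c (nth 0%N ws i).
have ws_uniq : uniq ws := cube_ws_uniq hstar hwhite_uniq hwhite_new.
have bs_uniq : uniq bs := cube_bs_uniq hstar hblack_uniq hblack_new.
have mod : models ws bs tl c (cube_model p) c.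
  exact: (cube_models hstar hwhite_new hblack_new).
have fresh : forall i, (i < size ws)%N -> fresh_tail bs (tl i).
  exact: (cube_fresh_tail hc hstar hwhite_uniq hwhite_new hblack_new).
have out_w : forall w b, w \notin ws -> b \in bs -> b \notin wrot c w.
  exact: (cube_outside_white hc hstar hwhite_new hblack_new).
have out_b : forall b i, b \notin bs -> (7 <= i < size ws)%N ->
    nth 0%N ws i \notin brot c b.
  by move=> b n _; apply: (cube_outside_black hc hstar hwhite_new hblack_new).
pose m n := run (cube_model p) (take n cube_moves).
(* The existential keeps [q] opaque, so that the run is not unfolded. *)
have [q def_q] : exists q, q = pt (m 12) by eexists.
(* The instances of [cube_moves] are convertible to [ms]. *)
have gen' : generic_run c [seq instance ws bs mv | mv <- cube_moves] := gen.
have q_pt n v : (n <= 12)%N -> (v < 15)%N ->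
    all (fun mv => v \notin created mv) (drop n cube_moves) ->
    pt (run c (take n ms)) (nth 0%N ws v) = q v.
  by apply: (@pt_stage _ _ ws bs tl c c p).
(* The seven old vertices are never created by a move, so they keep their initial points. *)
have qP v : (v < 7)%N -> q v = P (nth 0%N ws v).
  move=> lt_v; rewrite -(q_pt 0%N) ?take0 // ?(ltn_trans lt_v) //.
  by do 7 (case: v lt_v => [|v] lt_v; first by []).
have qE := (qP 0%N isT, qP 1%N isT, qP 2%N isT, qP 3%N isT, qP 4%N isT,
  qP 5%N isT, qP 6%N isT).
have [ij ik jk] : [/\ i != j, i != k & j != k].
  by move: hijk; rewrite /= !inE negb_or andbT => /andP[/andP[]].
have cop1 : coplanar [:: P A'; P B; P D; P C].
  rewrite /P hA' hB hC hD.
  exact: (coplanar_nth (hf u j k jk) (l := [:: 3; 1; 0; 2]%N)).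
have cop2 : coplanar [:: P A; P B'; P C; P D].
  rewrite /P hA hB' hC hD.
  exact: (coplanar_nth (hf u i k ik) (l := [:: 1; 3; 2; 0]%N)).
have cop3 : coplanar [:: P A; P D; P B; P C'].
  rewrite /P hA hB hC' hD.
  exact: (coplanar_nth (hf u i j ij) (l := [:: 1; 0; 2; 3]%N)).
(* The three faces through the last vertex are based at u + e_i, u + e_j and u + e_k, each in the
   two other directions. *)
have cop4 : coplanar [:: P A; P B'; PD'; P C'].
  rewrite /P hA hB' hC'.
  exact: (coplanar_nth (hf (u + unit_step i) j k jk) (l := [:: 0; 2; 3; 1]%N)).
have cop5 : coplanar [:: P A'; P B; P C'; PD'].
  rewrite /P hA' hB hC' /PD' [u + unit_step i + unit_step j]addrAC.
  exact: (coplanar_nth (hf (u + unit_step j) i k ik) (l := [:: 2; 0; 1; 3]%N)).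
have cop6 : coplanar [:: P B'; P C; P A'; PD'].
  have := hf (u + unit_step k) i j ij; rewrite /P hA' hB' hC.
  rewrite [u + unit_step k + unit_step i]addrAC [u + unit_step k + _]addrAC.
  rewrite [_ + unit_step k + unit_step j]addrAC => cop.
  exact: (coplanar_nth cop (l := [:: 1; 0; 2; 3]%N)).
have dim_planes : [/\ \dim (P A + P B' + P C')%VS = 3%N,
    \dim (P A' + P B + P C')%VS = 3%N & \dim (P A' + P B' + P C)%VS = 3%N].
  have := @dim_opposite_planes _ _ ws bs tl c c p erefl erefl ws_uniq bs_uniq
    fresh out_w out_b mod gen' q def_q.
  by rewrite !qE.
have [dim1 dim2 dim3] := dim_planes.
(* The last vertex of the Q-net plays Y: each face through it is coplanar and its other three points
   are independent, which puts it in their plane. *)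
have [] := @cube_points _ _ ws bs tl c c p erefl erefl ws_uniq bs_uniq
  fresh out_w out_b mod gen' q def_q PD' (dim_homog _).
- rewrite !qE; apply: coplanar_sub dim1;
  exact: (coplanar_nth cop4 (l := [:: 0; 1; 3; 2]%N)).
- rewrite !qE; apply: coplanar_sub dim2; exact: cop5.
- rewrite !qE; apply: coplanar_sub dim3;
  exact: (coplanar_nth cop6 (l := [:: 2; 0; 1; 3]%N)).
rewrite !qE => qD' q_F q_E cap_planes.
have final : models ws bs tl c (m 12) r.
  exact: (@models_stage _ _ ws bs tl c c p erefl erefl ws_uniq bs_uniq
    fresh out_w out_b mod 12).
have [wrot_r brot_r _ out_wr out_br] := final.
have wrotE v l : (v < 15)%N -> cyc_eqb (wrot (m 12) v) l ->
    cyc_eq (wrot r (nth 0%N ws v)) (expand bs (tl v) l).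
  move=> lt_v /cyc_eqP cyc_v; apply: cyc_eq_trans (wrot_r v lt_v) _.
  exact: cyc_eq_expand.
have brotE v l : (v < 11)%N -> cyc_eqb (brot (m 12) v) l ->
    cyc_eq (brot r (nth 0%N bs v)) (expand ws [::] l).
  move=> lt_v /cyc_eqP cyc_v; apply: cyc_eq_trans (brot_r v lt_v) _.
  exact: cyc_eq_expand.
have dead_wrot v : (7 <= v < 14)%N -> wrot r (nth 0%N ws v) = [::].
  case/andP=> le_v lt_v; apply: (models_wrot_nil final); first exact: ltnW.
  by do 14 (case: v le_v lt_v => [|v] le_v lt_v; first by []).
(* The black vertices that survive are s1, s2, s3, of indices 3, 5, 7. *)
have dead_brot v : (v < 11)%N -> v \notin [:: 3; 5; 7]%N ->
    brot r (nth 0%N bs v) = [::].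
  move=> lt_v live_v; apply: (models_brot_nil final) => //.
  by do 11 (case: v lt_v live_v => [|v] lt_v live_v; first by []).
have new_wrot v : (7 <= v < 15)%N -> wrot c (nth 0%N ws v) = [::].
  case/andP=> le_v lt_v; apply: (models_wrot_nil mod) => //; exact: nth_default.
have new_brot v : (3 <= v < 11)%N -> brot c (nth 0%N bs v) = [::].
  case/andP=> le_v lt_v; apply: (models_brot_nil mod) => //; exact: nth_default.
split.
- by [].
- have merge := @mergeable_cube_moves _ _ ws bs tl c c p erefl erefl ws_uniq
    bs_uniq fresh out_w out_b mod gen' q def_q.
  have legal12 : legal_run ws bs 7 (cube_model p) cube_moves.
    exact: (@legal_cube_moves _ _ 12).
  exact: (models_admissible_run ws_uniq bs_uniq fresh out_w out_b mod
    legal12 merge).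
- split.
  + rewrite (q_pt 1%N 7%N) //.
    have -> := @pt_G _ _ p q def_q.
    by rewrite !qE.
  + rewrite (q_pt 1%N 8%N) //.
    have -> := @pt_H _ _ p q def_q.
    by rewrite !qE.
  + by rewrite (q_pt 3%N 9%N).
  + by rewrite (q_pt 5%N 12%N).
- split.
  + split.
    * split.
        (* The names are distinct because they expand a duplicate-free list of indices. *)
        exact: (expand_uniq ws_uniq (nil_fresh ws)
          (l := [:: 14; 4; 5; 6; 1; 2; 3]%N)).
      exact: (expand_uniq bs_uniq (nil_fresh bs) (l := [:: 7; 5; 3]%N)).
    * have := wrotE 14%N [:: 7; 5; 3]%N isT isT; exact.
    * split; [ have := brotE 7%N [:: 14; 5; 1; 6]%N isT isT
             | have := brotE 5%N [:: 14; 6; 2; 4]%N isT isT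
             | have := brotE 3%N [:: 14; 4; 3; 5]%N isT isT ]; exact.
    * split; [ have := wrotE 4%N [:: 3; 5; 11]%N isT isT
             | have := wrotE 5%N [:: 7; 3; 11]%N isT isT
             | have := wrotE 6%N [:: 5; 7; 11]%N isT isT ];
        by rewrite /expand /= cats0.
    * split; [ have := wrotE 1%N [:: 7; 11]%N isT isT
             | have := wrotE 2%N [:: 5; 11]%N isT isT
             | have := wrotE 3%N [:: 3; 11]%N isT isT ];
        by rewrite /expand /= cats0.
  + split; last exact: (models_wrot_nil final (i := 0%N)).
    move=> w w_cube; case: (boolP (w \in ws)) => [|/out_wr[] //].
    case/(nthP 0%N)=> v lt_v def_w; rewrite -{}def_w in w_cube *.
    (* Indices below 7 and index 14 are excluded by [w_cube]; those between have no neighbors either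
       before or after the run. *)
    case: (ltnP v 7) => [lt_v7|le_v].
      by clear lt_v; do 7 (case: v lt_v7 w_cube => [|v] lt_v7 w_cube;
        first by rewrite !inE eqxx ?orbT in w_cube).
    case: (ltnP v 14) => [lt_v14|le_v14].
      by rewrite new_wrot ?le_v ?dead_wrot ?le_v.
    have def_v : v = 14%N by apply/eqP; rewrite eqn_leq le_v14 -ltnS lt_v.
    by rewrite def_v !inE eqxx ?orbT in w_cube.
  + split=> b.
      move=> b_cube; case: (boolP (b \in bs)) => [|/out_br //].
      case/(nthP 0%N)=> v lt_v def_b; rewrite -{}def_b in b_cube *.
      case: (ltnP v 3) => [lt_v3|le_v].
        by clear lt_v; do 3 (case: v lt_v3 b_cube => [|v] lt_v3 b_cube;
          first by rewrite !inE eqxx ?orbT in b_cube).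
      rewrite new_brot ?le_v // dead_brot //.
      by rewrite !inE !negb_or; apply/and3P;
         split; apply: contraNneq b_cube => ->; rewrite !inE eqxx ?orbT.
    by rewrite !inE => /or3P[] /eqP->; [ apply: (dead_brot 0%N)
      | apply: (dead_brot 1%N) | apply: (dead_brot 2%N)].
  + rewrite -qD'; exact: (q_pt 12%N 14%N isT isT isT).
  + move=> w w_live; case: (boolP (w \in ws)) => [|/out_wr[] //].
    case/(nthP 0%N)=> v lt_v def_w; rewrite -{}def_w in w_live *.
    case: (ltnP v 7) => [lt_v7 _|le_v].
      by rewrite -(qP v lt_v7); apply: (q_pt 12%N).
    case: (ltnP v 14) => [lt_v14|le_v14].
      by rewrite dead_wrot ?le_v in w_live.
    have -> : v = 14%N by apply/eqP; rewrite eqn_leq le_v14 -ltnS lt_v.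
    by rewrite eqxx.
- by split.
Qed.
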